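(* Let $Q$ be a 2-connected quiver. Then $$\frac{B_{\mu_Q}}{(1-q^{-1})^{\sharp Q_0}}=\frac{A_Q}{1-q^{-1}}.$$
   Context: A quiver $Q=(Q_0,Q_1,s,t)$ has finite vertex set $Q_0$ and arrow set $Q_1$. $Q$ is 2-connected if its underlying graph is connected and remains connected after removing any single edge. Let $\alpha\ge1$, $q$ a prime power and $\mathcal O_\alpha=\mathbb F_q[t]/(t^\alpha)$. A locally free representation of $Q$ over $\mathcal O_\alpha$ of rank $\underline 1=(1)_{i\in Q_0}$ is a tuple $x=(x_a)_{a\in Q_1}\in\mathcal O_\alpha^{Q_1}$; two of them are isomorphic iff they are related by the action $(g\cdot x)_a=g_{t(a)}x_ag_{s(a)}^{-1}$ of $(\mathcal O_\alpha^\times)^{Q_0}$. $A_{(Q,\alpha),\underline1}(q)$ is the number of isomorphism classes of absolutely indecomposable ones (indecomposable after base change to $\overline{\mathbb F_q}[t]/(t^\alpha)$; equivalently, the graph with vertex set $Q_0$ and edges $\{a\in Q_1: x_a\neq0\}$ is connected). The moment map is $\mu_{(Q,\alpha),\underline1}:\mathcal O_\alpha^{Q_1}\times\mathcal O_\alpha^{Q_1}\to\mathcal O_\alpha^{Q_0}$, $\mu(x,y)_i=\sum_{t(a)=i}x_ay_a-\sum_{s(a)=i}x_ay_a$, and $\sharp\mu^{-1}_{(Q,\alpha),\underline1}(0)(\mathbb F_q)$ is the number of pairs $(x,y)$ over $\mathcal O_\alpha$ with $\mu(x,y)=0$. Let $\langle\underline1,\underline1\rangle=\sharp Q_0-\sharp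 Q_1$. Define $$A_Q(q)=\lim_{\alpha\to+\infty}q^{-\alpha(1-\langle\underline1,\underline1\rangle)}A_{(Q,\alpha),\underline1}(q),\qquad B_{\mu_Q}(q)=\lim_{\alpha\to+\infty}q^{-\alpha(2\sharp Q_1-\sharp Q_0+1)}\,\sharp\mu_{(Q,\alpha),\underline1}^{-1}(0)(\mathbb F_q).$$ For $Q$ 2-connected both limits exist and are rational functions of $q$ (a known result of Wyss). *)

(* Defs.v *)
From HB Require Import structures.
From mathcomp Require Import all_boot all_order all_algebra all_field.
From mathcomp Require Import boolp classical_sets functions reals topology.
From mathcomp Require Import normedtype sequences.
Import Order.TTheory GRing.Theory Num.Theory.
Import numFieldNormedType.Exports.

Set Implicit Arguments.
Unset Strict Implicit.
Unset Printing Implicit Defensive.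

Local Open Scope ring_scope.

Record quiver := Quiver {
  vertex : finType;
  arrow : finType;
  src : arrow -> vertex;
  tgt : arrow -> vertex }.

Section Connectivity.
Variable Q : quiver.

Definition adjacent (E : {set arrow Q}) : rel (vertex Q) := fun i j =>
  [exists a in E, ((src a == i) && (tgt a == j))
               || ((src a == j) && (tgt a == i))].

(* The empty graph is not connected. *)
Definition graph_connected (E : {set arrow Q}) : bool :=
  (0 < #|vertex Q|)%N && [forall i, forall j, connect (adjacent E) i j].

Definition two_connected : bool :=
  graph_connected [set: arrow Q] && [forall a, graph_connected [set~ a]].

(* <1, 1> *)
Definition euler_form1 : int := #|vertex Q|%:Z - #|arrow Q|%:Z.

End Connectivity.

Section LocallyFreeReps.
Variables (Q : quiver) (S : comNzRingType).

(* The free module S^(d i) at the vertex i consists of column vectors, so the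
   arrow a acts by a matrix with d (tgt a) rows and d (src a) columns. *)
Definition lf_rep (d : vertex Q -> nat) : Type :=
  forall a : arrow Q, 'M[S]_(d (tgt a), d (src a)).

Definition lf_sum d e (x : lf_rep d) (y : lf_rep e) :
    lf_rep (fun i => d i + e i)%N :=
  fun a => block_mx (x a) 0 0 (y a).

(* Ranks are not required to agree a priori: the maps g i and h i are mutually
   inverse, which forces d =1 e, S being commutative and nonzero. *)
Definition lf_iso d e (x : lf_rep d) (y : lf_rep e) : Prop :=
  exists (g : forall i, 'M[S]_(e i, d i)) (h : forall i, 'M[S]_(d i, e i)),
    (forall i, h i *m g i = 1%:M /\ g i *m h i = 1%:M) /\
    (forall a, y a *m g (src a) = g (tgt a) *m x a).

(* Over a local ring a direct summand of a locally free representation is again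
   locally free, so only locally free summands have to be tested. *)
Definition indecomposable d (x : lf_rep d) : Prop :=
  ~ (forall i, d i = 0%N) /\
  forall d1 d2 (y : lf_rep d1) (z : lf_rep d2), lf_iso x (lf_sum y z) ->
    (forall i, d1 i = 0%N) \/ (forall i, d2 i = 0%N).

Definition rank1_rep (x : arrow Q -> S) : lf_rep (fun=> 1%N) :=
  fun a => (x a)%:M.

End LocallyFreeReps.

(* K[t]/(t^alpha). The library replaces the modulus by 'X when alpha = 0; this
   does not affect limits as alpha tends to infinity. *)
Notation truncPoly K alpha := {poly %/ ('X^alpha : {poly K})}.

Definition trunc_map (K L : fieldType) (f : {rmorphism K -> L}) (alpha : nat)
    (u : truncPoly K alpha) : truncPoly L alpha :=
  in_qpoly 'X^alpha (map_poly f (u : {poly K})).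

Definition alg_closure (F : countFieldType) : countClosedFieldType :=
  projT1 (countable_algebraic_closure F).

Definition to_alg_closure (F : countFieldType) :
    {rmorphism F -> alg_closure F} :=
  sval (projT2 (countable_algebraic_closure F)).

Section Counting.
Variables (F : finFieldType) (Q : quiver) (alpha : nat).
Local Notation O := (truncPoly F alpha).

Definition abs_indecomposable (x : {ffun arrow Q -> O}) : Prop :=
  indecomposable
    (rank1_rep (fun a => trunc_map (to_alg_closure F) (x a))).

Definition rank1_iso : rel {ffun arrow Q -> O} := fun x y =>
  [exists g : {ffun vertex Q -> O},
    [forall i, g i \is a GRing.unit] &&
    [forall a, y a == g (tgt a) * x a / g (src a)]].

Definition nb_abs_indec : nat :=
  #|equivalence_partition rank1_iso
      [set x : {ffun arrow Q -> O} | `[< abs_indecomposable x >]]|.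

Definition moment_map (x y : {ffun arrow Q -> O}) : {ffun vertex Q -> O} :=
  [ffun i => \sum_(a | tgt a == i) x a * y a - \sum_(a | src a == i) x a * y a].

Definition nb_moment_zero : nat :=
  #|[set p : {ffun arrow Q -> O} * {ffun arrow Q -> O}
      | moment_map p.1 p.2 == 0]|.

End Counting.

Section Limits.
Variables (R : realType) (F : finFieldType) (Q : quiver).
Local Notation q := (#|F|%:R : R).

Definition A_seq (alpha : nat) : R :=
  q ^ (- (alpha%:Z * (1 - euler_form1 Q))) * (nb_abs_indec F Q alpha)%:R.

Definition B_seq (alpha : nat) : R :=
  q ^ (- (alpha%:Z * (2 * #|arrow Q|%:Z - #|vertex Q|%:Z + 1)))
    * (nb_moment_zero F Q alpha)%:R.

Definition A_lim : R := limn A_seq.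

Definition B_lim : R := limn B_seq.

End Limits.

(* Main.v *)
(* Write O = F_q[t]/(t^n), Z(x) for the set of xi in O^(Q_0) satisfying
   x_a (xi_(t(a)) - xi_(s(a))) = 0 for every arrow a, and S for the sum of the
   #Z(x) over all x. Up to a power of q, #Z(x) is the number of y with
   mu(x, y) = 0, since mu(x, .) is dual to xi |-> (x_a (xi_(t(a)) - xi_(s(a))))_a;
   and Z(x) meets the torus in the stabiliser of x, which for x of connected
   support is the proportion 1 - 1/q of Z(x). Hence B_mu comes from S and A from the
   part of S over the x of connected support.
   The remaining part of S, as well as the defect in S_(n+1) >= q^(#Q_1+1) S_n
   (count the xi constant modulo t), is bounded by the sums over the quivers
   Q minus an arrow. These quivers are connected, so their sums are
   O(n^(#Q_1) q^(n #Q_1)), while S is normalised by q^(n (#Q_1+1)). *)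

From HB Require Import structures.
From mathcomp Require Import all_boot all_order all_algebra all_field.
From mathcomp Require Import boolp classical_sets functions reals topology.
From mathcomp Require Import normedtype sequences.
From mathcomp Require Import finset.
From mathcomp Require Import ring lra zify.
Require Import Defs.
Import Order.TTheory GRing.Theory Num.Theory.
Import numFieldNormedType.Exports.
Local Open Scope ring_scope.

Set Implicit Arguments.
Unset Strict Implicit.
Unset Printing Implicit Defensive.

(** * Arithmetic of K[t]/(t^(n+1)) *)

Section TruncatedPolynomials.
Variables (K : fieldType) (n : nat).
Local Notation O := (truncPoly K n.+1).

Lemma coef_in_qpoly (p : {poly K}) i :
  (in_qpoly 'X^(n.+1) p : {poly K})`_i = if (i < n.+1)%N then p`_i else 0.
Proof.
by rewrite /= mk_monic_Xn -Pdiv.RingMonic.take_poly_rmodp coef_take_poly.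
Qed.

Lemma coef_truncM (x y : O) i :
  (x * y : O)`_i = if (i < n.+1)%N then ((x : {poly K}) * y)`_i else 0.
Proof. exact: coef_in_qpoly. Qed.

Lemma coef_trunc_gt (x : O) i : (n < i)%N -> x`_i = 0.
Proof.
move=> ltni; apply: big_coef_npoly; apply: leq_trans ltni.
by rewrite mk_monic_Xn size_polyXn.
Qed.

Lemma truncP (x y : O) : (forall i, (i <= n)%N -> x`_i = y`_i) -> x = y.
Proof.
move=> eqxy; apply/npolyP => i.
by have [/eqxy//|lt_ni] := leqP i n; rewrite !coef_trunc_gt.
Qed.

Lemma coef_truncB (x y : O) i : (x - y : O)`_i = x`_i - y`_i.
Proof. exact: coefB. Qed.

Lemma trunc_unitE (x : O) : (x \is a GRing.unit) = (x`_0 != 0).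
Proof.
have mod0 (p : {poly K}) : coprimep (mk_monic 'X^(n.+1)) p = (p`_0 != 0).
  by rewrite mk_monic_Xn coprimep_sym coprimep_pexpr // coprimepX rootE horner_coef0.
exact: mod0.
Qed.

Lemma trunc_mul_eq0 (x y : O) : x != 0 -> x * y = 0 -> y`_0 = 0.
Proof.
move=> x_neq0 xy0; apply/eqP; apply: contraNT x_neq0.
rewrite -trunc_unitE => /mulrK yK.
by rewrite -[x]yK xy0 mul0r.
Qed.

(** Testing against y = t^(n-i) moves the coefficient of t^i in x to degree n. This top-coefficient
    pairing is the one that dualises the moment map. *)
Lemma trunc_pairing_nondegenerate (x : O) :
  (forall y : O, (x * y : O)`_n = 0) -> x = 0.
Proof.
move=> x0; apply: truncP => i le_in; rewrite coef0.
have := x0 (in_qpoly 'X^(n.+1) 'X^(n - i)).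
rewrite coef_truncM ltnS leqnn.
have -> : (in_qpoly 'X^(n.+1) 'X^(n - i) : {poly K}) = 'X^(n - i).
  by apply: in_qpoly_small; rewrite mk_monic_Xn !size_polyXn !ltnS leq_subr.
by rewrite coefMXn ltnNge leq_subr /= subKn.
Qed.

End TruncatedPolynomials.

Lemma card_trunc (F : finFieldType) n : #|truncPoly F n.+1| = (#|F| ^ n.+1)%N.
Proof. by rewrite card_qpoly mk_monic_Xn size_polyXn. Qed.

(** * From K[t]/(t^(n+1)) to K[t]/(t^(n+2)) *)

Section Lifting.
Variables (K : fieldType) (n : nat).

(** A coefficient is added below by [consX], as c + t x, and on top by [addXn], as x + c t^(n+1).
    The first suits multiples of t, the second their annihilators, since t kills the top term. *)
Definition consX (p : K * truncPoly K n.+1) : truncPoly K n.+2 :=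
  in_qpoly 'X^(n.+2) (p.1%:P + 'X * (p.2 : {poly K})).

Definition addXn (p : K * truncPoly K n.+1) : truncPoly K n.+2 :=
  in_qpoly 'X^(n.+2) ((p.2 : {poly K}) + p.1 *: 'X^(n.+1)).

Lemma coef_consX p i : (consX p)`_i = if i is j.+1 then p.2`_j else p.1.
Proof.
rewrite coef_in_qpoly coefD coefC coefXM.
case: i => [|i] /=; first by rewrite addr0.
by rewrite add0r ltnS; case: ltnP => // /coef_trunc_gt->.
Qed.

Lemma coef_addXn p i : (addXn p)`_i = if i == n.+1 then p.1 else p.2`_i.
Proof.
rewrite coef_in_qpoly coefD coefZ coefXn.
have [->|neq_in] := eqVneq i n.+1; first by rewrite ltnSn coef_trunc_gt // add0r mulr1.
by rewrite mulr0 addr0; case: ltnP => // /ltnW/coef_trunc_gt->.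
Qed.

Lemma consX_bij : bijective consX.
Proof.
exists (fun y : truncPoly K n.+2 =>
  (y`_0, in_qpoly 'X^(n.+1) (drop_poly 1 (y : {poly K})))) => [[c x]|y].
  congr (_, _); first by rewrite coef_consX.
  by apply: truncP => i le_in; rewrite coef_in_qpoly ltnS le_in coef_drop_poly addn1 coef_consX.
apply: truncP => -[|i] le_in; rewrite coef_consX //=.
by rewrite coef_in_qpoly le_in coef_drop_poly addn1.
Qed.

Lemma addXn_bij : bijective addXn.
Proof.
exists (fun y : truncPoly K n.+2 => (y`_n.+1, in_qpoly 'X^(n.+1) (y : {poly K}))) => [[c x]|y].
  congr (_, _); first by rewrite coef_addXn eqxx.
  by apply: truncP => i le_in; rewrite coef_in_qpoly ltnS le_in coef_addXn ltn_eqF ?ltnS.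
apply: truncP => i le_in; rewrite coef_addXn; case: eqVneq => [->//|neq_in].
by rewrite coef_in_qpoly ltn_neqAle neq_in le_in.
Qed.

Lemma consXB c x y : consX (c, x) - consX (c, y) = consX (0, x - y).
Proof.
by apply: truncP => -[|i] _; rewrite coef_truncB !coef_consX ?subrr ?coef_truncB.
Qed.

Lemma consX0 : consX (0, 0) = 0.
Proof. by apply: truncP => -[|i] _; rewrite coef_consX /= !coef0. Qed.

Lemma addXn_consX_eq0 e x y :
  (addXn (e, x) * consX (0, y) == 0) = (x * y == 0).
Proof.
have -> : addXn (e, x) * consX (0, y) = consX (0, x * y).
  rewrite -in_qpolyM; apply: truncP => i le_in.
  rewrite coef_in_qpoly ltnS le_in polyC0 add0r mulrCA coefXM coef_consX.
  case: i le_in => //= i le_in.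
  rewrite coef_truncM le_in mulrDl coefD -scalerAl coefZ coefXnM le_in.
  by rewrite mulr0 addr0.
by rewrite -consX0 (inj_eq (bij_inj consX_bij)) xpair_eqE eqxx.
Qed.

End Lifting.

(** * Sizes of annihilators *)

Section Annihilators.
Variable F : finFieldType.
Local Notation O n := (truncPoly F n.+1).
Local Notation q := #|F|.

Definition nb_ann n (z : O n) : nat := #|[set x : O n | x * z == 0]|.

Lemma nb_ann_le n (z : O n) : (nb_ann z <= q ^ n.+1)%N.
Proof. by rewrite -card_trunc max_card. Qed.

Lemma nb_ann_consX n (z : O n) : nb_ann (consX (0, z)) = (q * nb_ann z)%N.
Proof.
rewrite -[q]cardsT -cardsX -(card_imset _ (bij_inj (@addXn_bij F n))).
apply: eq_card => y; rewrite !inE.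
have [g gK Kg] := addXn_bij F n.
rewrite -[y]Kg mem_imset ?inE; last exact: can_inj gK.
by case: (g y) => e x; rewrite addXn_consX_eq0.
Qed.

Lemma nb_ann_unit n (z : O n) : z`_0 != 0 -> nb_ann z = 1%N.
Proof.
rewrite -trunc_unitE => zU; rewrite -(cards1 (0 : O n)); apply: eq_card => x.
by rewrite !inE -[x == 0](inj_eq (mulIr zU)) mul0r.
Qed.

Lemma sum_consX n (f : O n.+1 -> nat) :
  (\sum_z f z = \sum_(c : F) \sum_(z : O n) f (consX (c, z)))%N.
Proof.
rewrite (reindex (@consX F n)) /=; last exact: onW_bij (consX_bij F n).
by rewrite pair_big; apply: eq_bigr => -[].
Qed.

(** Induction through the constant coefficient of z: units have trivial annihilator and contribute
    at most the order of the ring, while the multiples of t contribute q times the sum one level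
    below. Each level thus adds only one to the linear factor. *)
Lemma sum_nb_ann_le n : (\sum_(z : O n) nb_ann z <= n.+2 * q ^ n.+1)%N.
Proof.
elim: n => [|n IHn].
  rewrite (bigD1 0) //= mulSn mul1n leq_add ?nb_ann_le //.
  rewrite (eq_bigr (fun=> 1%N)) => [|z z_neq0].
    by rewrite sum1_card -card_trunc max_card.
  apply: nb_ann_unit; apply: contraNneq z_neq0 => z0; apply/eqP/truncP => i.
  by rewrite leqn0 coef0 => /eqP->.
rewrite sum_consX (bigD1 0) //= addnC mulSn leq_add //.
  rewrite -card_trunc -sum1_card sum_consX [leqRHS](bigD1 0) //=.
  apply: leq_trans (leq_addl _ _); apply: leq_sum => c c_neq0.
  by apply: leq_sum => z _; rewrite nb_ann_unit // coef_consX.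
rewrite (eq_bigr (fun z => q * nb_ann z)%N) => [|z _]; last exact: nb_ann_consX.
by rewrite -big_distrr /= expnS mulnCA leq_mul2l IHn orbT.
Qed.

End Annihilators.

(** * Edge sums and their dependence on the set of arrows *)

Lemma connect_eq_fun (Q : quiver) (T : Type) (f : vertex Q -> T) (E : {set arrow Q}) i j :
  {in E, forall a, f (tgt a) = f (src a)} -> connect (adjacent E) i j -> f i = f j.
Proof.
move=> eqf /connectP[p]; elim: p i => [|i' p IHp] i /=; first by move=> _ ->.
case/andP=> /exists_inP[a Ea adj_a] path_p lastp; rewrite -(IHp i') //.
by case/orP: adj_a => /andP[/eqP <- /eqP <-]; rewrite eqf.
Qed.

Section EdgeSums.
Variables (F : finFieldType) (Q : quiver) (n : nat).
Local Notation O := (truncPoly F n.+1).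
Local Notation q := #|F|.
Implicit Types (k : O -> nat) (xi : {ffun vertex Q -> O}) (E : {set arrow Q}).

Definition coboundary xi (a : arrow Q) : O := xi (tgt a) - xi (src a).

(** With k = [nb_ann] this counts the pairs (x, xi) with x supported on E and each x_a killing the
    coboundary at a; with k = [is0] it counts the xi constant on the components of E. The common
    form lets one induction compare the two. *)
Definition edge_sum k E : nat :=
  (\sum_(xi : {ffun vertex Q -> O}) \prod_(a in E) k (coboundary xi a))%N.

Definition is0 (z : O) : nat := z == 0.

Lemma sum_is0 : (\sum_z is0 z = 1)%N.
Proof. by rewrite (bigD1 0) //= /is0 eqxx big1 ?addn0 // => z /negPf->. Qed.

Lemma edge_sum0 k : edge_sum k set0 = ((q ^ n.+1) ^ #|vertex Q|)%N.
Proof.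
rewrite /edge_sum (eq_bigr (fun=> 1%N)) => [|xi _]; last by rewrite big_set0.
by rewrite sum1_card card_ffun card_trunc.
Qed.

Lemma coboundary_connected E xi i j :
  {in E, forall a, coboundary xi a = 0} -> connect (adjacent E) i j ->
  xi i = xi j.
Proof.
move=> xi0; apply: connect_eq_fun => a /xi0/eqP.
by rewrite subr_eq0 => /eqP.
Qed.

Lemma prod_is0 E xi :
  (\prod_(a in E) is0 (coboundary xi a))%N = [forall a in E, coboundary xi a == 0].
Proof.
have [/forall_inP xi0|] := boolP [forall a in E, coboundary xi a == 0].
  by rewrite big1 // => a /xi0; rewrite /is0 => ->.
rewrite negb_forall => /existsP[a]; rewrite negb_imply => /andP[Ea /negPf nz].
by rewrite (bigD1 a) //= /is0 nz.
Qed.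

Lemma edge_sum_is0_connected E a :
  connect (adjacent E) (src a) (tgt a) ->
  edge_sum is0 (a |: E) = edge_sum is0 E.
Proof.
move=> conn_a; apply: eq_bigr => xi _; rewrite !prod_is0; congr nat_of_bool.
apply/forall_inP/forall_inP => [xi0 b Eb|xi0 b]; first by rewrite xi0 ?inE ?Eb ?orbT.
rewrite !inE => /predU1P[->|]; last exact: xi0.
rewrite subr_eq0; apply/eqP/esym; apply: coboundary_connected conn_a => c Ec.
exact/eqP/xi0.
Qed.

Lemma adjacent_sym E : symmetric (adjacent E).
Proof.
by move=> i j; apply: eq_existsb => a; rewrite orbC.
Qed.

(* Moving the component of [src a] by a constant [c] changes the coboundary at
   [a] by [c] and nowhere on [E], so the value at [a] is equidistributed. *)
Lemma edge_sum_disconnected k E a :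
  ~~ connect (adjacent E) (src a) (tgt a) ->
  (q ^ n.+1 * edge_sum k (a |: E) = edge_sum k E * \sum_c k c)%N.
Proof.
move=> disc_a; pose C := connect (adjacent E) (src a).
pose shift (c : O) xi := [ffun i => if C i then xi i - c else xi i].
have shift_bij c : bijective (shift c).
  exists (shift (- c)) => xi; apply/ffunP => i; rewrite !ffunE; case: (C i) => //.
    by rewrite opprK subrK.
  by rewrite opprK addrK.
have shift_a c xi : coboundary (shift c xi) a = coboundary xi a + c.
  rewrite /coboundary !ffunE /C connect0 (negPf disc_a) opprB.
  by rewrite addrA [RHS]addrAC.
have shift_E c xi b : b \in E -> coboundary (shift c xi) b = coboundary xi b.
  move=> Eb; rewrite /coboundary !ffunE.
  have adj_b : connect (adjacent E) (src b) (tgt b).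
    by apply/connect1/exists_inP; exists b; rewrite ?eqxx.
  have -> : C (src b) = C (tgt b).
    exact: (same_connect_r (sym_connect_sym (adjacent_sym E)) adj_b).
  by case: ifP; rewrite // opprB addrA addrNK.
have aNE : a \notin E.
  apply: contra disc_a => Ea.
  by apply/connect1/exists_inP; exists a; rewrite ?eqxx.
rewrite -card_trunc -sum1_card big_distrl /=.
under eq_bigr => c _.
  rewrite mul1n /edge_sum (reindex (shift c)) /=; last exact: onW_bij.
  under eq_bigr => xi _.
    rewrite big_setU1 //= shift_a.
    under eq_bigr => b Eb do rewrite shift_E //.
  over.
over.
rewrite exchange_big /= big_distrl /=; apply: eq_bigr => xi _.
rewrite -big_distrl /= mulnC; congr (_ * _)%N.
by rewrite [RHS](reindex_inj (addrI (coboundary xi a))).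
Qed.

(** Arrows are added one at a time. If a joins vertices already connected, the [is0] sum is
    unchanged and the factor at a is at most q^(n+1). Otherwise each sum is multiplied by the mean
    value of its weight: at most n + 2 for [nb_ann], and q^-(n+1) for [is0]. *)
Lemma edge_sum_ann_le E :
  (edge_sum (@nb_ann F n) E
     <= n.+2 ^ #|E| * (q ^ n.+1) ^ #|E| * edge_sum is0 E)%N.
Proof.
have qn_gt0 : (0 < q ^ n.+1)%N by rewrite -card_trunc; apply/card_gt0P; exists 0.
have [m leEm] := ubnP #|E|; elim: m E leEm => // m IHm E.
have [->|/set0Pn[a Ea]] := eqVneq E set0.
  by rewrite !edge_sum0 cards0 !expn0 !mul1n.
rewrite -(setD1K Ea) cardsU1 !inE eqxx add1n ltnS.
set E' := E :\ a => /IHm {}IHm; rewrite !(expnS _ #|E'|).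
have [conn_a|disc_a] := boolP (connect (adjacent E') (src a) (tgt a)).
  rewrite edge_sum_is0_connected //.
  apply: (@leq_trans (q ^ n.+1 * edge_sum (@nb_ann F n) E')).
    rewrite /edge_sum big_distrr /=; apply: leq_sum => xi _.
    by rewrite big_setU1 ?inE ?eqxx //= leq_mul // nb_ann_le.
  rewrite [leqRHS](_ : _ = n.+2 * (q ^ n.+1 * (n.+2 ^ #|E'| * (q ^ n.+1) ^ #|E'|
     * edge_sum is0 E')))%N; last by ring.
  by rewrite (leq_trans _ (leq_pmull _ _)) // leq_mul2l IHm orbT.
have disc_sum k := edge_sum_disconnected k disc_a.
have := disc_sum is0; rewrite sum_is0 muln1 => sumE'.
rewrite -(leq_pmul2l qn_gt0) disc_sum.
apply: leq_trans (leq_mul IHm (sum_nb_ann_le F n)) _.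
rewrite -sumE'; move: (q ^ n.+1)%N (_ ^ _)%N (_ ^ _)%N (edge_sum _ _) => X A B I.
by apply/eq_leq; ring.
Qed.

Lemma edge_sum_is0_graph_connected E :
  graph_connected E -> (edge_sum is0 E <= q ^ n.+1)%N.
Proof.
case/andP=> /card_gt0P[i0 _] /forallP conn.
pose D := [set xi : {ffun vertex Q -> O} | [forall a in E, coboundary xi a == 0]].
have -> : edge_sum is0 E = #|D|.
  rewrite -sum1_card big_mkcond; apply: eq_bigr => xi _.
  by rewrite prod_is0 inE; case: ifP.
rewrite -card_trunc -(@card_in_imset _ _ (fun xi : {ffun vertex Q -> O} => xi i0)).
  exact: max_card.
move=> xi xi'; rewrite !inE => /forall_inP xi0 /forall_inP xi'0 eq_i0.
have {}conn i : connect (adjacent E) i0 i by have /forallP := conn i0.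
apply/ffunP => i; transitivity (xi i0); last rewrite eq_i0.
  apply/esym; apply: coboundary_connected (conn i) => a /xi0 /eqP; exact.
by apply: coboundary_connected (conn i) => a /xi'0 /eqP.
Qed.

(* The index [n] stands for alpha = n + 1, here and below. *)
Definition nb_pairs : nat := edge_sum (@nb_ann F n) [set: arrow Q].

Definition nb_pairs_del : nat :=
  (\sum_a edge_sum (@nb_ann F n) [set~ a])%N.

Lemma nb_pairs_del_le : two_connected Q ->
  (nb_pairs_del <= #|arrow Q| * n.+2 ^ #|arrow Q| * (q ^ n.+1) ^ #|arrow Q|)%N.
Proof.
case/andP=> _ /forallP conn; rewrite -mulnA -sum_nat_const; apply: leq_sum => a _.
apply: leq_trans (edge_sum_ann_le _) _.
have m_gt0 : (0 < #|arrow Q|)%N by apply/card_gt0P; exists a.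
rewrite -mulnA; apply: leq_mul; first by rewrite leq_pexp2l // max_card.
(* Q minus a has one arrow fewer; the factor q^(n+1) saved there pays for the constant xi on this
   connected graph. *)
rewrite -[X in (_ <= _ ^ X)%N](prednK m_gt0) (expnSr (q ^ n.+1)) cardsC1; apply: leq_mul => //.
exact: edge_sum_is0_graph_connected.
Qed.

End EdgeSums.

(** * Comparison of consecutive levels *)

Section LevelStep.
Variables (F : finFieldType) (Q : quiver) (n : nat).
Local Notation O n := (truncPoly F n.+1).
Local Notation q := #|F|.
Hypothesis connQ : graph_connected [set: arrow Q].

(** Parametrises the xi constant modulo t, as c + t y with c common to all vertices. *)
Definition consX_ffun (p : F * {ffun vertex Q -> O n}) : {ffun vertex Q -> O n.+1} :=
  [ffun i => consX (p.1, p.2 i)].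

Lemma consX_ffun_inj : injective consX_ffun.
Proof.
case/andP: connQ => /card_gt0P[i0 _] _ [c y] [c' y'] /ffunP eq_p.
have {}eq_p i : (c, y i) = (c', y' i).
  by apply: (bij_inj (@consX_bij F n)); have := eq_p i; rewrite !ffunE.
case: (eq_p i0) => -> _; congr (_, _); apply/ffunP => i.
by case: (eq_p i).
Qed.

(* Either [xi] is constant modulo t, or some [coboundary xi a] is a unit, which
   forces x_a = 0. *)
Lemma nb_pairs_step :
  (q ^ #|arrow Q|.+1 * nb_pairs F Q n <= nb_pairs F Q n.+1
     <= q ^ #|arrow Q|.+1 * nb_pairs F Q n + nb_pairs_del F Q n.+1)%N.
Proof.
pose B := [set consX_ffun p | p : F * {ffun vertex Q -> O n}].
pose f (xi : {ffun vertex Q -> O n.+1}) :=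
  (\prod_(a in [set: arrow Q]) nb_ann (coboundary xi a))%N.
(* On B the coboundary of xi is t times that of y, so each of the #Q_1 factors gains a q; the choice
   of c gives one more. *)
have -> : (q ^ #|arrow Q|.+1 * nb_pairs F Q n = \sum_(xi in B) f xi)%N.
  rewrite big_imset /=; last by move=> p p' _ _; apply: consX_ffun_inj.
  rewrite (eq_bigr (fun p => q ^ #|arrow Q| * \prod_(a in [set: arrow Q])
      nb_ann (coboundary p.2 a)))%N; last first.
    move=> [c y] _ /=; rewrite -[#|arrow Q|]cardsT -prod_nat_const -big_split /=.
    apply: eq_bigr => a _.
    by rewrite /coboundary !ffunE /= consXB nb_ann_consX.
  rewrite -(pair_bigA _ (fun c (y : {ffun vertex Q -> O n}) => q ^ #|arrow Q| *
     \prod_(a in [set: arrow Q]) nb_ann (coboundary y a)))%N /=.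
  by rewrite sum_nat_const -big_distrr /= mulnA expnS.
have -> : nb_pairs F Q n.+1 = (\sum_(xi in B) f xi + \sum_(xi | xi \notin B) f xi)%N.
  exact: bigID.
rewrite leq_addr leq_add2l /= /nb_pairs_del exchange_big /= big_mkcond /=.
apply: leq_sum => xi _; case: ifP => // xiNB.
have [/existsP[a Ua]|] := boolP [exists a, (coboundary xi a)`_0 != 0].
  rewrite (bigD1 a) //= /f (bigD1 a) //= nb_ann_unit // mul1n.
  apply: leq_trans (leq_addr _ _); apply: eq_leq; apply: eq_bigl => b.
  by rewrite !inE.
rewrite negb_exists => /forallP xi0; case/negP: xiNB.
case/andP: connQ => /card_gt0P[i0 _] /forallP conn.
have {}xi0 i : (xi i0)`_0 = (xi i)`_0.
  apply: (connect_eq_fun (f := fun i => (xi i)`_0) (E := [set: arrow Q])).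
    move=> a _; have := xi0 a; rewrite negbK coef_truncB subr_eq0.
    by move/eqP.
  by have /forallP := conn i0.
have [g gK Kg] := consX_bij F n.
apply/imsetP; exists ((xi i0)`_0, [ffun i => (g (xi i)).2]) => //.
apply/ffunP => i; rewrite !ffunE /= (xi0 i) -{1}[xi i]Kg.
by congr consX; rewrite -{2}[xi i]Kg coef_consX; case: (g _).
Qed.

End LevelStep.

(** * Counting kernels of additive and bilinear maps over a finite field *)

HB.instance Definition _ (aT : finType) (rT : finZmodType) :=
  GRing.Zmodule.on {ffun aT -> rT}.

(** Translation by w0 preserves D and identifies the zero fibre of g with the fibre over c, so all q
    fibres within D have equal size. *)
Lemma card_zero_fiber (F : finFieldType) (W : finZmodType) (D : {set W}) (g : W -> F) :
  {morph g : w w' / w - w'} ->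
  (forall c, exists2 w0, g w0 = c & forall w, (w - w0 \in D) = (w \in D)) ->
  (#|F| * #|[set w in D | g w == 0%R]| = #|D|)%N.
Proof.
move=> gB g_surj; rewrite -sum_nat_const -[#|D|]sum1_card (partition_big g predT) //=.
apply: eq_big => // c _; have [w0 gw0 Dw0] := g_surj c.
rewrite -sum1dep_card (reindex (fun w => w - w0)) /=; last first.
  by exists (fun w => w + w0) => w _; rewrite ?addrK ?subrK.
by apply: eq_bigl => w; rewrite gB gw0 subr_eq0 Dw0.
Qed.

(* Count the pairs (u, w) with [f u w = 0] in two ways: each row and each column
   is either full or has proportion 1/q. *)
Lemma card_bilinear_kernels (F : finFieldType) (U W : finZmodType)
    (f : U -> W -> F) :
  (forall u, {morph f u : w w' / w - w'}) ->
  (forall w, {morph f^~ w : u u' / u - u'}) ->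
  (forall u w c, exists w', f u w' = c * f u w) ->
  (forall u w c, exists u', f u' w = c * f u w) ->
  (#|[set u | [forall w, f u w == 0%R]]| * #|W|
     = #|[set w | [forall u, f u w == 0%R]]| * #|U|)%N.
Proof.
move=> fBr fBl fZr fZl; set q := #|F|.
have q_gt1 : (1 < q)%N by apply: finNzRing_gt1.
have row (T T' : finZmodType) (h : T -> T' -> F) :
    (forall u, {morph h u : w w' / w - w'}) ->
    (forall u w c, exists w', h u w' = c * h u w) ->
    (q * \sum_u #|[set w | h u w == 0%R]|
       = (q - 1) * (#|[set u | [forall w, h u w == 0%R]]| * #|T'|) + #|T| * #|T'|)%N.
  move=> hB hZ.
  have -> : #|[set u | [forall w, h u w == 0]]| = (\sum_u [forall w, h u w == 0%R])%N.
    by rewrite -sum1_card big_mkcond; apply: eq_bigr => u _; rewrite inE; case: ifP.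
  rewrite -[(#|T| * _)%N]sum_nat_const big_distrl !big_distrr -big_split /=.
  apply: eq_bigr => u _.
  have [/forallP h0|] := boolP [forall w, h u w == 0].
    have -> : [set w | h u w == 0] = [set: T'] by apply/setP=> w; rewrite !inE h0.
    by rewrite cardsT mul1n mulnBl mul1n subnK // leq_pmull // ltnW.
  rewrite negb_forall /= mul0n muln0 add0n => /existsP[w0 hw0].
  rewrite -[#|T'|]cardsT -(card_zero_fiber (g := h u)) => [||c] //.
    by congr (_ * _)%N; apply: eq_card => w; rewrite !inE.
  have [w hw] := hZ u w0 (c / h u w0).
  by exists w => [|w']; rewrite ?inE // hw divfK.
have rows := row _ _ f fBr fZr.
have cols := row _ _ (fun w u => f u w) fBl (fun w u c => fZl u w c).
have swap : (\sum_u #|[set w | f u w == 0%R]| = \sum_w #|[set u | f u w == 0%R]|)%N.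
  under eq_bigr => u _ do rewrite -sum1dep_card big_mkcond.
  rewrite exchange_big /=; apply: eq_bigr => w _.
  by rewrite -sum1dep_card [RHS]big_mkcond.
have q1_gt0 : (0 < q - 1)%N by rewrite subn_gt0.
(* Both expressions count the same zeros; once the common term #U #W is removed, the factor q - 1
   cancels. *)
move: rows; rewrite swap cols (mulnC #|U|) => /addIn/eqP.
by rewrite eqn_pmul2l // => /eqP ->.
Qed.

(** * Duality between [flat x] and the zero fibre of mu(x, .) *)

Section Duality.
Variables (F : finFieldType) (Q : quiver) (n : nat).
Local Notation O := (truncPoly F n.+1).
Local Notation q := #|F|.
Implicit Types (x y : {ffun arrow Q -> O}) (xi : {ffun vertex Q -> O}).

Definition flat x : {set {ffun vertex Q -> O}} :=
  [set xi | [forall a, x a * coboundary xi a == 0]].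

(** After exchanging the sums, xi is fixed and x is chosen independently at each arrow: in the
    annihilator of the coboundary on E, and 0 off E. *)
Lemma sum_flat (E : {set arrow Q}) :
  (\sum_(x : {ffun arrow Q -> O} | [forall a, (a \notin E) ==> (x a == 0%R)]) #|flat x|
     = edge_sum (@nb_ann F n) E)%N.
Proof.
under eq_bigr => x _ do rewrite /flat -sum1dep_card big_mkcond.
rewrite exchange_big /=; apply: eq_bigr => xi _.
rewrite -big_mkcondr sum1dep_card.
pose D a : {set O} := [set z | if a \in E then z * coboundary xi a == 0 else z == 0].
rewrite (eq_card (B := family D)) => [|x]; last first.
  rewrite !inE; apply/andP/familyP => [[/forallP xE /forallP x0] a|xD].
    by have := xE a; have := x0 a; rewrite inE; case: ifP.
  split; apply/forallP => a; have := xD a; rewrite inE; case: ifP => //.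
  by move=> _ /eqP ->; rewrite mul0r.
rewrite card_family foldrE big_map big_enum /=.
rewrite (bigID (mem E)) /= [X in (_ * X)%N]big1 ?muln1 => [|a /negPf aE].
  by apply: eq_bigr => a aE; apply: eq_card => z; rewrite !inE aE.
by rewrite -(cards1 (0 : O)); apply: eq_card => z; rewrite !inE aE.
Qed.

(** Summation by parts: each arrow contributes at its target and, with the opposite sign, at its
    source. *)
Lemma coboundary_moment_map x y xi :
  \sum_a x a * y a * coboundary xi a = \sum_i xi i * moment_map x y i.
Proof.
under [RHS]eq_bigr => i _ do rewrite ffunE mulrBr !big_distrr /=.
rewrite sumrB.
have endpoint (e : arrow Q -> vertex Q) :
    \sum_i \sum_(a | e a == i) xi i * (x a * y a) = \sum_a x a * y a * xi (e a).
  rewrite [RHS](partition_big e predT) //=; apply: eq_bigr => i _.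
  by apply: eq_bigr => a /eqP <-; rewrite mulrC.
by rewrite !endpoint -sumrB; apply: eq_bigr => a _; rewrite mulrBr.
Qed.

(** The top coefficient of the sum in [coboundary_moment_map] is a bilinear form in xi and y. By
    nondegeneracy of the pairing on O, its kernels are [flat x] and the zero fibre of mu(x, .), and
    [card_bilinear_kernels] compares their sizes. *)
Lemma card_moment_fiber x :
  (#|flat x| * (q ^ n.+1) ^ #|arrow Q|
    = #|[set y | moment_map x y == 0%R]| * (q ^ n.+1) ^ #|vertex Q|)%N.
Proof.
pose lam (z : O) := z`_n.
have lamB z z' : lam (z - z') = lam z - lam z' by exact: coef_truncB.
have lamZ c z : lam (c *: z) = c * lam z by exact: coefZ.
have lam0 : lam 0 = 0 by exact: coef0.
have lam_nondeg z : (forall z', lam (z * z') = 0) -> z = 0.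
  exact: trunc_pairing_nondegenerate.
pose f xi y := lam (\sum_a x a * y a * coboundary xi a).
rewrite -card_trunc -!card_ffun.
have <- : [set xi | [forall y, f xi y == 0]] = flat x.
  apply/setP => xi; rewrite !inE; apply/forallP/forallP => [f0 a|xi0 y]; last first.
    rewrite /f big1 ?lam0 // => a _.
    by rewrite mulrAC (eqP (xi0 a)) mul0r.
  apply/eqP/lam_nondeg => z.
  rewrite -(eqP (f0 [ffun b => if b == a then z else 0])) /f.
  congr lam; rewrite (bigD1 a) //= big1 => [|b /negPf ba].
    by rewrite ffunE eqxx addr0 mulrAC.
  by rewrite ffunE ba mulr0 mul0r.
have <- : [set y | [forall xi, f xi y == 0]] = [set y | moment_map x y == 0].
  apply/setP => y; rewrite !inE; apply/forallP/eqP => [f0|y0 xi]; last first.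
    rewrite /f coboundary_moment_map big1 ?lam0 // => i _.
    by rewrite y0 ffunE mulr0.
  apply/ffunP => i; rewrite [RHS]ffunE; apply: lam_nondeg => z.
  rewrite -(eqP (f0 [ffun j => if j == i then z else 0])) /f.
  congr lam; rewrite coboundary_moment_map (bigD1 i) //= big1 => [|j /negPf ji].
    by rewrite [X in X * _ + _]ffunE eqxx addr0 mulrC.
  by rewrite [X in X * _]ffunE ji mul0r.
apply: card_bilinear_kernels => [xi y y'|y xi xi'|xi y c|xi y c].
- rewrite /f -lamB -sumrB; congr lam; apply: eq_bigr => a _.
  by rewrite -mulrBl -mulrBr !ffunE.
- rewrite /f -lamB -sumrB; congr lam; apply: eq_bigr => a _.
  by rewrite /coboundary !ffunE -mulrBr; congr (_ * _); ring.
- exists [ffun a => c *: y a].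
  rewrite /f -lamZ; congr lam; rewrite scaler_sumr; apply: eq_bigr => a _.
  by rewrite ffunE -scalerAr -scalerAl.
- exists [ffun i => c *: xi i].
  rewrite /f -lamZ; congr lam; rewrite scaler_sumr; apply: eq_bigr => a _.
  by rewrite /coboundary !ffunE -scalerBr scalerAr.
Qed.

Lemma nb_moment_zeroE :
  (nb_moment_zero F Q n.+1 * (q ^ n.+1) ^ #|vertex Q|
     = nb_pairs F Q n * (q ^ n.+1) ^ #|arrow Q|)%N.
Proof.
have -> : nb_pairs F Q n = (\sum_x #|flat x|)%N.
  rewrite /nb_pairs -sum_flat; apply: eq_bigl => x.
  by apply/forallP => a; rewrite inE.
rewrite big_distrl /=.
have -> : nb_moment_zero F Q n.+1 =
    (\sum_(x : {ffun arrow Q -> O}) #|[set y | moment_map x y == 0%R]|)%N.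
  rewrite /nb_moment_zero -sum1dep_card.
  under [RHS]eq_bigr => x _ do rewrite -sum1dep_card.
  by rewrite pair_big_dep.
by rewrite big_distrl /=; apply: eq_bigr => x _; rewrite card_moment_fiber.
Qed.

End Duality.

(** * Indecomposability in rank one as connectedness of the support *)

Section RankOneIndecomposable.
Variables (Q : quiver) (S : comNzRingType).
Implicit Types x : arrow Q -> S.

Definition supp_arrows x : {set arrow Q} := [set a | x a != 0].

(** The products g_i h_j are the entries of an identity matrix. For two distinct indices, (g_0
    h_0)(g_1 h_1) = 1 regroups by commutativity into a product with the factor g_0 h_1 = 0; with no
    index, h g would be 0. *)
Lemma rank1_split_dim (d1 d2 : nat) (g : 'M[S]_(d1 + d2, 1)) (h : 'M[S]_(1, d1 + d2)) :
  h *m g = 1%:M -> g *m h = 1%:M -> (d1 + d2 = 1)%N.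
Proof.
move: (d1 + d2)%N g h => d g h hg gh.
have gh_ij i j : g i 0 * h 0 j = (i == j)%:R.
  by have /matrixP/(_ i j) := gh; rewrite !mxE big_ord1.
have /matrixP/(_ 0 0) := hg; rewrite !mxE eqxx mulr1n.
case: d g h {hg gh} gh_ij => [|[|d]] g h gh_ij //.
  by rewrite big_ord0 => /esym/eqP; rewrite oner_eq0.
move=> _; have := gh_ij ord0 ord_max; have := gh_ij ord0 ord0.
have := gh_ij ord_max ord_max; rewrite !eqxx => g1 g0 g01.
have /eqP := oner_neq0 S; case.
rewrite -[LHS]mulr1 -[X in X * _]g0 -[X in _ * X]g1.
by rewrite [g ord_max _ * _]mulrC mulrACA g01 mul0r.
Qed.

(** Booleans serve as dimensions 0 and 1. As b + ~~b reduces to 1 only by cases on b, columns of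
    ones identify the sum with the rank one module. If v is nonzero, one diagonal block is the
    scalar v and the other is empty. *)
Lemma block_const_mx1 (b1 b2 : bool) (v : S) : (v != 0 -> b1 = b2) ->
  block_mx (const_mx v : 'M_(b1, b2)) 0 0 (const_mx v : 'M_(~~ b1, ~~ b2)) *m
    (const_mx 1 : 'M_(b2 + ~~ b2, 1))
  = (const_mx 1 : 'M_(b1 + ~~ b1, 1)) *m v%:M.
Proof.
have const0 p r : const_mx 0 = 0 :> 'M[S]_(p, r) by [].
have [->|_ /(_ isT) <-] := eqVneq v 0.
  by rewrite !const0 block_mx0 mul0mx raddf0 mulmx0.
case: b1; apply/matrixP => i j; rewrite !mxE !big_ord1 !mxE !ord1 mul1r mulr1.
  by case: splitP => [k _|[]//]; rewrite !mxE; case: splitP => [l _|[]//]; rewrite !mxE.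
by case: splitP => [[]//|k _]; rewrite !mxE; case: splitP => [[]//|l _]; rewrite !mxE.
Qed.

Lemma indecomposable_rank1 x :
  indecomposable (rank1_rep x) <-> graph_connected (supp_arrows x).
Proof.
split=> [[V_ne0 indec]|/andP[/card_gt0P[i0 _] /forallP conn]].
  have V_gt0 : (0 < #|vertex Q|)%N.
    rewrite lt0n; apply/eqP => V0; apply: V_ne0 => i.
    by have := fintype0 i V0.
  rewrite /graph_connected V_gt0; apply/forallP => i; apply/forallP => j.
  apply: contraT => disc; pose C k := connect (adjacent (supp_arrows x)) i k.
  (* If j is outside the component C of i, then x is the sum of its restrictions to C and to the
     complement, since x_a = 0 for every arrow between them. *)
  pose y : lf_rep S (fun k => C k : nat) := fun a => const_mx (x a).
  pose z : lf_rep S (fun k => ~~ C k : nat) := fun a => const_mx (x a).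
  case: (indec _ _ y z) => [|/(_ i)|/(_ j)].
  - exists (fun k => const_mx 1), (fun k => const_mx 1); split=> [k|a].
      by case: (C k); split; apply/matrixP => r s; rewrite !mxE big_ord1 !mxE !ord1 eqxx mulr1.
    apply: block_const_mx1 => xa_neq0.
    apply: (same_connect_r (sym_connect_sym (adjacent_sym _))).
    apply/connect1/exists_inP; exists a; rewrite ?inE ?eqxx ?orbT //.
  - by rewrite /C connect0.
  - by rewrite /C (negPf disc).
split=> [/(_ i0)//|d1 d2 y z [g [h [ghK gx]]]].
have dim1 i : (d1 i + d2 i = 1)%N by case: (ghK i); apply: rank1_split_dim.
have d1_arrow a : a \in supp_arrows x -> d1 (tgt a) = d1 (src a).
  rewrite inE => xa_neq0; apply: contraNeq xa_neq0 => neq_d1.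
  (* If d1 differs at the two ends of a, both diagonal blocks are empty, so the sum acts by 0 at a;
     the isomorphism then forces x_a = 0. *)
  have gx0 : g (tgt a) *m rank1_rep x a = 0.
    rewrite -gx (_ : lf_sum y z a = 0) ?mul0mx //.
    apply/matrixP => r s; rewrite !mxE; case: splitP => r' _; rewrite !mxE; case: splitP => s' _;
      rewrite ?mxE //; have := dim1 (tgt a); have := dim1 (src a); case: r' s' => r' + [s' +]; lia.
  have := congr1 (mulmx (h (tgt a))) gx0; rewrite mulmxA (ghK _).1 mul1mx mulmx0.
  by move/matrixP/(_ 0 0); rewrite !mxE eqxx => /eqP.
have d1_const i : d1 i0 = d1 i.
  apply: (connect_eq_fun d1_arrow); by have /forallP := conn i0.
have [d10|d1_neq0] := eqVneq (d1 i0) 0%N; [left|right] => i; first by rewrite -d1_const.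
by have := dim1 i; rewrite -d1_const; lia.
Qed.

End RankOneIndecomposable.

(** * Isomorphism classes as torus orbits *)

Section CountingIsoClasses.
Variables (F : finFieldType) (Q : quiver) (n : nat).
Local Notation O := (truncPoly F n.+1).
Local Notation q := #|F|.
Implicit Types (x y : {ffun arrow Q -> O}) (g h xi : {ffun vertex Q -> O}).

(** Extension of scalars is injective on coefficients, so the support is unchanged, and
    [indecomposable_rank1] applies over the larger ring. *)
Lemma abs_indecomposableE x :
  abs_indecomposable x <-> graph_connected (supp_arrows x).
Proof.
have trunc_map_eq0 (u : O) : (trunc_map (to_alg_closure F) u == 0) = (u == 0).
  apply/eqP/eqP => [u0|->]; apply: truncP => i le_in.
    have : (trunc_map (to_alg_closure F) u)`_i = 0 by rewrite u0 coef0.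
    rewrite coef_in_qpoly ltnS le_in coef_map coef0 => /eqP.
    by rewrite fmorph_eq0 => /eqP.
  by rewrite coef_in_qpoly ltnS le_in coef_map !coef0; apply: rmorph0.
rewrite /abs_indecomposable indecomposable_rank1.
rewrite (_ : supp_arrows _ = supp_arrows x) //.
by apply/setP => a; rewrite !inE trunc_map_eq0.
Qed.

Definition unit_ffuns : {set {ffun vertex Q -> O}} :=
  [set g : {ffun vertex Q -> O} | [forall i, g i \is a GRing.unit]].

Definition act g x : {ffun arrow Q -> O} := [ffun a => g (tgt a) * x a / g (src a)].

Lemma rank1_isoP x y :
  reflect (exists2 g, g \in unit_ffuns & y = act g x) (rank1_iso x y).
Proof.
apply: (iffP existsP) => [[g /andP[gU /forallP yE]]|[g gU ->]].
  by exists g; rewrite ?inE //; apply/ffunP => a; rewrite ffunE (eqP (yE a)).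
by exists g; move: gU; rewrite inE => ->; apply/forallP => a; rewrite ffunE.
Qed.

Lemma unit_ffunsP g : reflect (forall i, g i \is a GRing.unit) (g \in unit_ffuns).
Proof. by rewrite inE; apply: forallP. Qed.

Definition mul_ffun g h : {ffun vertex Q -> O} := [ffun i => g i * h i].
Definition inv_ffun g : {ffun vertex Q -> O} := [ffun i => (g i)^-1].

Lemma mul_ffunC : commutative mul_ffun.
Proof. by move=> g h; apply/ffunP => i; rewrite !ffunE mulrC. Qed.

Lemma mul_unit_ffun g h :
  g \in unit_ffuns -> h \in unit_ffuns -> mul_ffun g h \in unit_ffuns.
Proof.
move=> /unit_ffunsP gU /unit_ffunsP hU.
by apply/unit_ffunsP => i; rewrite ffunE unitrM gU hU.
Qed.

Lemma inv_unit_ffun g : g \in unit_ffuns -> inv_ffun g \in unit_ffuns.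
Proof. by move=> /unit_ffunsP gU; apply/unit_ffunsP => i; rewrite ffunE unitrV. Qed.

Lemma act_mul g h x : g \in unit_ffuns -> h \in unit_ffuns ->
  act (mul_ffun g h) x = act g (act h x).
Proof.
move=> /unit_ffunsP gU /unit_ffunsP hU; apply/ffunP => a; rewrite !ffunE.
by rewrite invrM // !mulrA.
Qed.

Lemma mul_invK g h : g \in unit_ffuns -> mul_ffun g (mul_ffun (inv_ffun g) h) = h.
Proof.
by move=> /unit_ffunsP gU; apply/ffunP => i; rewrite !ffunE mulVKr.
Qed.

(** Clearing the inverse turns the fixed point equation into x_a (g_(t(a)) - g_(s(a))) = 0. The
    stabiliser of x is thus the torus part of [flat x]. *)
Lemma act_fixed g x : g \in unit_ffuns -> (act g x == x) = (g \in flat x).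
Proof.
move=> /unit_ffunsP gU; rewrite inE; apply/eqP/forallP => [/ffunP gx a|xg].
  have := gx a; rewrite ffunE => /(canRL (mulrVK (gU _))) eq_gx.
  by rewrite mulrBr mulrC eq_gx subrr.
apply/ffunP => a; rewrite ffunE; apply: (canLR (mulrK (gU _))).
by have := xg a; rewrite mulrBr subr_eq0 mulrC => /eqP ->.
Qed.

Lemma act_eq0 g x a : g \in unit_ffuns -> (act g x a == 0) = (x a == 0).
Proof.
move=> /unit_ffunsP gU; rewrite ffunE.
rewrite -[0 in LHS](mul0r (g (src a))^-1) (inj_eq (mulIr _)) ?unitrV //.
by rewrite -[0 in LHS](mulr0 (g (tgt a))) (inj_eq (mulrI _)).
Qed.

Lemma supp_act g x : g \in unit_ffuns -> supp_arrows (act g x) = supp_arrows x.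
Proof. by move=> gU; apply/setP => a; rewrite !inE act_eq0. Qed.

Lemma rank1_iso_equiv : equivalence_rel (@rank1_iso F Q n.+1).
Proof.
have one_U : [ffun=> 1] \in unit_ffuns by apply/unit_ffunsP => i; rewrite ffunE unitr1.
have act1 x : act [ffun=> 1] x = x by apply/ffunP => a; rewrite !ffunE mul1r divr1.
apply/equivalence_relP; split=> [x|x y /rank1_isoP[g gU ->] z].
  by apply/rank1_isoP; exists [ffun=> 1]; rewrite ?act1.
apply/rank1_isoP/rank1_isoP => -[h hU ->].
  exists (mul_ffun h (inv_ffun g)); first by rewrite mul_unit_ffun ?inv_unit_ffun.
  rewrite -act_mul ?mul_unit_ffun ?inv_unit_ffun //; congr act.
  apply/ffunP => i; rewrite !ffunE mulrVK //; exact/unit_ffunsP.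
by exists (mul_ffun h g); rewrite ?act_mul // mul_unit_ffun.
Qed.

(** Orbit-stabiliser: the torus is partitioned by the value of [act g x0], and the fibre over x is a
    coset of the stabiliser of x. *)
Lemma sum_orbit_flat (X : {set {ffun arrow Q -> O}}) x0 :
    (forall g, g \in unit_ffuns -> act g x0 \in X) ->
  (\sum_(x in [set x in X | rank1_iso x0 x]) #|unit_ffuns :&: flat x|
     = #|unit_ffuns|)%N.
Proof.
move=> actX; rewrite -[RHS]sum1_card.
rewrite [RHS](partition_big (fun g => act g x0) (mem [set x in X | rank1_iso x0 x]))
  /=; last first.
  by move=> g gU; rewrite inE actX //; apply/rank1_isoP; exists g.
apply: eq_bigr => x; rewrite inE => /andP[_ /rank1_isoP[g gU ->]].
rewrite -sum1_card; symmetry.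
rewrite (reindex (mul_ffun g)) /=; last first.
  exists (mul_ffun (inv_ffun g)) => h _; last exact: mul_invK.
  by apply/ffunP => i; rewrite !ffunE mulKr //; apply/unit_ffunsP.
apply: eq_bigl => h; rewrite in_setI; apply/andP/andP => -[].
  move=> /unit_ffunsP ghU; have hU : h \in unit_ffuns.
    by apply/unit_ffunsP => i; have := ghU i; rewrite ffunE unitrM => /andP[].
  rewrite mul_ffunC act_mul // => fixed_h; split=> //.
  by rewrite -act_fixed.
move=> hU; rewrite -act_fixed // -act_mul // mul_ffunC => fixed_h.
by split=> //; apply: mul_unit_ffun.
Qed.

Lemma nb_abs_indec_units :
  (nb_abs_indec F Q n.+1 * #|unit_ffuns|
    = \sum_(x : {ffun arrow Q -> O} | graph_connected (supp_arrows x))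
        #|unit_ffuns :&: flat x|)%N.
Proof.
rewrite /nb_abs_indec; set X := [set x | _].
have XE x : (x \in X) = graph_connected (supp_arrows x).
  by rewrite inE; apply/asboolP/idP => /abs_indecomposableE.
have partX : partition (equivalence_partition (@rank1_iso F Q n.+1) X) X.
  by apply: equivalence_partitionP => x y z _ _ _; apply: rank1_iso_equiv.
under [RHS]eq_bigl => x do rewrite -XE.
case/and3P: partX => /eqP covX trivX _.
rewrite -[in RHS]covX big_trivIset //= -sum_nat_const.
apply: eq_bigr => A /imsetP[x0 Xx0 ->]; apply/esym/sum_orbit_flat => g gU.
by rewrite XE supp_act // -XE.
Qed.

(** Units are the elements of nonzero constant term, a proportion 1 - 1/q of O; the factor q^(#Q_0)
    on the left avoids division. *)
Lemma card_unit_ffuns :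
  (#|unit_ffuns| * q ^ #|vertex Q| = ((q - 1) * q ^ n.+1) ^ #|vertex Q|)%N.
Proof.
have -> : #|unit_ffuns| = (#|[set z : O | (z`_0 != 0)%R]| ^ #|vertex Q|)%N.
  rewrite -card_ffun_on; apply: eq_card => g; rewrite inE.
  apply/forallP/ffun_onP => gU i; have := gU i; rewrite inE trunc_unitE //.
rewrite -expnMn -card_trunc; congr (_ ^ _)%N.
pose ev0 (z : O) := z`_0.
have ev0B : {morph ev0 : z z' / z - z'} by move=> z z'; apply: coef_truncB.
have card0 : (q * #|[set z in [set: O] | ev0 z == 0%R]| = #|[set: O]|)%N.
  apply: card_zero_fiber => // c; exists (qpolyC _ c); first by rewrite /ev0 [LHS]coefC.
  by move=> z; rewrite !inE.
have -> : [set z : O | z`_0 != 0] = [set: O] :\: [set z in [set: O] | ev0 z == 0].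
  by apply/setP => z; rewrite !inE andbT.
rewrite cardsD setTI mulnC mulnBr card0 cardsT mulnBl mul1n.
by rewrite -[X in (_ - X)%N]cardsT -card0.
Qed.

(** Where x_a is nonzero, the coboundary it kills is not a unit, so all xi_i have the same constant
    coefficient and invertibility is decided at i0. Adding constants to xi preserves [flat x], so
    that coefficient is equidistributed. *)
Lemma card_unit_flat x : graph_connected (supp_arrows x) ->
  (q * #|unit_ffuns :&: flat x| = (q - 1) * #|flat x|)%N.
Proof.
case/andP=> /card_gt0P[i0 _] /forallP conn.
pose ev0 xi := (xi i0)`_0.
have ev0B : {morph ev0 : xi xi' / xi - xi'}.
  by move=> xi xi'; rewrite /ev0 -coef_truncB !ffunE.
have := card_zero_fiber (D := flat x) ev0B=> card0.
have {}card0 : (q * #|[set xi in flat x | ev0 xi == 0%R]| = #|flat x|)%N.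
  apply: card0 => c; exists [ffun=> qpolyC _ c]; first by rewrite /ev0 ffunE [LHS]coefC.
  move=> xi; rewrite !inE; apply: eq_forallb => a.
  by rewrite /coboundary !ffunE opprB addrA addrNK.
have -> : unit_ffuns :&: flat x = flat x :\: [set xi in flat x | ev0 xi == 0].
  apply/setP => xi; rewrite in_setD in_setI [in RHS]inE andbC [RHS]andbC.
  case: (boolP (xi \in flat x)) => //= flat_xi.
  apply/unit_ffunsP/idP => [/(_ i0)|xi0 i]; rewrite trunc_unitE //.
  move: xi0; rewrite /ev0 (@connect_eq_fun _ _ (fun i => (xi i)`_0) (supp_arrows x) i0 i) //.
    move=> a; rewrite inE => xa_neq0.
    apply/eqP; rewrite -subr_eq0 -coef_truncB; apply/eqP.
    apply: trunc_mul_eq0 xa_neq0 _; apply/eqP.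
    by move: flat_xi; rewrite inE => /forallP.
  by have /forallP := conn i0.
rewrite cardsD (setIidPr _); last by apply/fintype.subsetP => xi; rewrite inE => /andP[].
by rewrite -card0 mulnBr mulnBl mul1n mulnA.
Qed.

End CountingIsoClasses.

(** * Real sequences with geometric error terms *)

Section RealSequences.
Variable R : realType.

(** Induction on m with r = s^2: one factor s^n bounds the first m powers of n + 1, the other bounds
    the last. *)
Lemma poly_le_geometric m (r : R) : 1 < r ->
  exists2 C : R, 0 <= C & forall n, n.+1%:R ^+ m <= C * r ^+ n.
Proof.
elim: m r => [|m IHm] r r_gt1.
  by exists 1 => // n; rewrite expr0 mul1r exprn_ege1 // ltW.
pose s := Num.sqrt r.
have s_gt1 : 1 < s by rewrite -sqrtr1 ltr_sqrt // (lt_trans _ r_gt1).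
have [C C_ge0 le_C] := IHm s s_gt1.
have s1_gt0 : 0 < s - 1 by rewrite subr_gt0.
(* Then D >= 1 and D (s - 1) = s >= 1, so D s^n grows by at least 1 at each step. *)
pose D := 1 + (s - 1)^-1.
have D_ge0 : 0 <= D by rewrite addr_ge0 // invr_ge0 ltW.
have le_D n : n.+1%:R <= D * s ^+ n.
  elim: n => [|n IHn]; first by rewrite expr0 mulr1 lerDl invr_ge0 ltW.
  rewrite -natr1 exprS mulrCA -[X in X * (D * _)](subrK 1 s) mulrDl mul1r addrC.
  apply: lerD IHn => //.
  have : 1 <= s ^+ n by rewrite exprn_ege1 // ltW.
  move=> sn_ge1; rewrite mulrA mulrDr mulr1 divff ?gt_eqF //.
  have : 0 <= s - 1 by rewrite ltW.
  nra.
exists (C * D) => [|n]; first by rewrite mulr_ge0.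
have -> : r ^+ n = s ^+ n * s ^+ n.
  by rewrite -exprMn -expr2 sqr_sqrtr // ltW // (lt_trans ltr01).
by rewrite exprSr mulrACA ler_pM ?exprn_ge0.
Qed.

Lemma nondecreasing_cvgn_geometric (u : nat -> R) (K r : R) :
  0 <= K -> 0 <= r < 1 -> (forall n, u n <= u n.+1 <= u n + K * r ^+ n) ->
  cvgn u.
Proof.
move=> K_ge0 /andP[r_ge0 r_lt1] u_step.
have r1_gt0 : 0 < 1 - r by rewrite subr_gt0.
apply: nondecreasing_is_cvgn.
  by apply/nondecreasing_seqP => n; case/andP: (u_step n).
exists (u 0%N + K / (1 - r)) => _ [n _ <-].
(* The induction needs the partial sums of the geometric series, not just their bound. *)
have : u n <= u 0%N + K / (1 - r) * (1 - r ^+ n).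
  elim: n => [|n IHn]; first by rewrite expr0 subrr mulr0 addr0.
  case/andP: (u_step n) => _ /le_trans -> //.
  apply: le_trans (lerD IHn (lexx _)) _.
  rewrite -addrA lerD2l exprS le_eqVlt; apply/orP; left; apply/eqP.
  by field; rewrite gt_eqF.
move=> /le_trans -> //; rewrite lerD2l ler_piMr ?divr_ge0 ?(ltW r1_gt0) //.
by rewrite gerBl exprn_ge0.
Qed.

Lemma cvg_dist_geometric (u v : nat -> R) (l K r : R) :
  0 <= r < 1 -> (forall n, v n <= u n <= v n + K * r ^+ n) ->
  (u @ \oo --> l -> v @ \oo --> l)%classic.
Proof.
move=> /andP[r_ge0 r_lt1] uv cvg_u.
apply: (@squeeze_cvgr _ _ _ _ (fun n => u n - K * r ^+ n) u) => //.
- by apply: nearW => n; case/andP: (uv n) => -> le; rewrite lerBlDr le.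
- rewrite -[l]subr0; apply: cvgB => //.
  by apply: cvg_geometric; rewrite ger0_norm.
Qed.

End RealSequences.

(** * Asymptotics of the normalised counts *)

Section Asymptotics.
Variables (R : realType) (F : finFieldType) (Q : quiver).
Hypothesis hQ : two_connected Q.
Local Notation q := (#|F|%:R : R).
Local Notation V := #|vertex Q|.
Local Notation m := #|arrow Q|.

Let connQ : graph_connected [set: arrow Q].
Proof. by case/andP: hQ. Qed.

Definition nb_pairs_conn n : nat :=
  (\sum_(x : {ffun arrow Q -> truncPoly F n.+1} | graph_connected (supp_arrows x))
     #|flat x|)%N.

(** As Q is connected, an x of disconnected support vanishes at some arrow a, and its pairs are
    counted for Q minus a. *)
Lemma nb_pairs_conn_bounds n :
  (nb_pairs_conn n <= nb_pairs F Q n <= nb_pairs_conn n + nb_pairs_del F Q n)%N.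
Proof.
have -> : nb_pairs F Q n =
    (\sum_(x : {ffun arrow Q -> truncPoly F n.+1}) #|flat x|)%N.
  rewrite /nb_pairs -sum_flat; apply: eq_bigl => x.
  by apply/forallP => a; rewrite inE.
rewrite [X in (_ <= X <= _)%N](bigID (fun x : {ffun arrow Q -> truncPoly F n.+1} =>
  graph_connected (supp_arrows x))) /=.
rewrite leq_addr leq_add2l /= /nb_pairs_del.
under [leqRHS]eq_bigr => a _ do rewrite -sum_flat big_mkcond.
rewrite exchange_big big_mkcond /=; apply: leq_sum => x _; case: ifP => // disc_x.
have /existsP[a xa0] : [exists a, x a == 0].
  apply: contraTT connQ; rewrite negb_exists => /forallP x_neq0.
  have <- : supp_arrows x = [set: arrow Q]; last by rewrite disc_x.
  by apply/setP => a; rewrite !inE x_neq0.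
rewrite (bigD1 a) //= ifT ?leq_addr //; apply/forallP => b.
by rewrite !inE negbK; apply/implyP => /eqP ->.
Qed.

Let q_gt1 : 1 < q.
Proof. by rewrite ltr1n finNzRing_gt1. Qed.

Let q_gt0 : 0 < q.
Proof. exact: lt_trans q_gt1. Qed.

Let q_neq0 : q != 0.
Proof. by rewrite gt_eqF. Qed.

(** The exponent is alpha (#Q_1 + 1) for alpha = n + 1. Both normalisations reduce to it, after the
    duality factor for B and the order of the torus for A. *)
Definition normalized (u : nat -> nat) n : R := (u n)%:R / q ^+ (n.+1 * m.+1).

Lemma B_seqE n : B_seq R F Q n.+1 = normalized (nb_pairs F Q) n.
Proof.
have := congr1 (fun k : nat => k%:R : R) (nb_moment_zeroE F Q n).
rewrite !natrM !natrX -!exprM => momE.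
rewrite /B_seq /normalized -[(nb_moment_zero _ _ _)%:R](mulfK (x := q ^+ (n.+1 * V))) ?expf_neq0 //.
rewrite momE mulrCA -mulrA; congr (_ * _).
rewrite !exprnP !invr_expz -!expfzDr //; congr (_ ^ _).
lia.
Qed.

Lemma A_seqE n :
  A_seq R F Q n.+1 = (1 - q^-1) / (1 - q^-1) ^+ V * normalized nb_pairs_conn n.
Proof.
have units_conn : (q - 1) * (nb_pairs_conn n)%:R
    = q * (nb_abs_indec F Q n.+1)%:R * #|unit_ffuns F Q n|%:R.
  have q_ge1 : (1 <= #|F|)%N by rewrite ltnW // finNzRing_gt1.
  rewrite -[1 in LHS]/(1%:R) -natrB // -!natrM; congr _%:R.
  rewrite -mulnA nb_abs_indec_units /nb_pairs_conn !big_distrr /=.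
  by apply: eq_bigr => x conn_x; rewrite -card_unit_flat.
have units_card : #|unit_ffuns F Q n|%:R * q ^+ V = ((q - 1) * q ^+ n.+1) ^+ V.
  have q_ge1 : (1 <= #|F|)%N by rewrite ltnW // finNzRing_gt1.
  by rewrite -[1 in RHS]/(1%:R) -natrB // -!natrX -!natrM -natrX card_unit_ffuns.
have q1_neq0 : 1 - q^-1 != 0 by rewrite subr_eq0 gt_eqF // invf_lt1.
have {}units_card : #|unit_ffuns F Q n|%:R = (1 - q^-1) ^+ V * q ^+ (n.+1 * V).
  apply: (mulIf (expf_neq0 V q_neq0)); rewrite units_card exprM -!exprMn.
  by congr (_ ^+ _); field.
rewrite /A_seq /normalized.
have -> : (nb_pairs_conn n)%:R = (1 - q^-1) ^+ V * q ^+ (n.+1 * V) / (1 - q^-1)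
    * (nb_abs_indec F Q n.+1)%:R.
  rewrite -units_card; apply: (mulfI (_ : q - 1 != 0)); first by rewrite subr_eq0 gt_eqF.
  rewrite units_conn; field.
  by rewrite q_neq0 subr_eq0 gt_eqF.
rewrite [RHS](_ : _ = (q ^+ (n.+1 * V) / q ^+ (n.+1 * m.+1)) * (nb_abs_indec F Q n.+1)%:R);
  last first.
  move: (expf_neq0 V q1_neq0) (expf_neq0 (n.+1 * m.+1) q_neq0) (q1_neq0).
  set P := _ ^+ V; set X := q ^+ _; set Y := q ^+ _; set p := 1 - _.
  move: P X Y p => P X Y p P_neq0 Y_neq0 p_neq0.
  by field; rewrite ?P_neq0 ?Y_neq0 ?p_neq0.
congr (_ * _); rewrite !exprnP !invr_expz -!expfzDr //; congr (_ ^ _).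
rewrite /euler_form1; lia.
Qed.

Lemma normalized_pairs_step :
  exists2 K : R, 0 <= K & forall n,
    normalized (nb_pairs F Q) n <= normalized (nb_pairs F Q) n.+1
      <= normalized (nb_pairs F Q) n + K * (3 / 4) ^+ n /\
    normalized nb_pairs_conn n <= normalized (nb_pairs F Q) n
      <= normalized nb_pairs_conn n + K * (3 / 4) ^+ n.
Proof.
(* The ratio 3/2 exceeds 1 and, divided by q >= 2, is at most 3/4. *)
have [C C_ge0 leC] := @poly_le_geometric R m (3 / 2) ltac:(lra).
have q_ge2 : 2 <= q by rewrite ler_nat finNzRing_gt1.
have qX_gt0 k : 0 < q ^+ k by rewrite exprn_gt0.
have r_ge0 k : 0 <= (3 / 4 : R) ^+ k by rewrite exprn_ge0 //; lra.
have K_ge0 : 0 <= m%:R * C by rewrite mulr_ge0.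
have del_le n : normalized (nb_pairs_del F Q) n <= m%:R * C * (3 / 4) ^+ n.+1.
  rewrite ler_pdivrMr //.
  have := nb_pairs_del_le F n hQ; rewrite -(ler_nat R) => /le_trans; apply.
  rewrite !natrM !natrX -mulrA -[leRHS]mulrA -mulrA ler_wpM2l //.
  rewrite -exprM mulnS exprD.
  rewrite [leRHS](_ : _ = C * ((3 / 4) ^+ n.+1 * q ^+ n.+1) * q ^+ (n.+1 * m)); last by ring.
  rewrite ler_wpM2r ?(ltW (qX_gt0 _)) // (le_trans (leC _)) // ler_wpM2l //.
  rewrite -exprMn lerXn2r ?nnegrE; lra.
have del_le' n : normalized (nb_pairs_del F Q) n <= m%:R * C * (3 / 4) ^+ n.
  apply: le_trans (del_le n) _; rewrite ler_wpM2l // exprS ler_piMl //; lra.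
exists (m%:R * C) => // n.
have dist_conn : normalized nb_pairs_conn n <= normalized (nb_pairs F Q) n
      <= normalized nb_pairs_conn n + normalized (nb_pairs_del F Q) n.
  by rewrite -mulrDl -natrD !ler_pM2r ?invr_gt0 // !ler_nat nb_pairs_conn_bounds.
have step : normalized (nb_pairs F Q) n <= normalized (nb_pairs F Q) n.+1
      <= normalized (nb_pairs F Q) n + normalized (nb_pairs_del F Q) n.+1.
  have -> : normalized (nb_pairs F Q) n
      = (#|F| ^ m.+1 * nb_pairs F Q n)%:R / q ^+ (n.+2 * m.+1).
    rewrite natrM natrX mulSn exprD /normalized; field.
    by rewrite !gt_eqF.
  rewrite -mulrDl -natrD !ler_pM2r ?invr_gt0 // !ler_nat.
  exact: nb_pairs_step.
split.
  case/andP: step => -> /le_trans -> //; rewrite lerD2l.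
  by apply: le_trans (del_le n.+1) _; rewrite ler_wpM2l // !exprS; have := r_ge0 n; nra.
by case/andP: dist_conn => -> /le_trans -> //; rewrite lerD2l.
Qed.

End Asymptotics.

Theorem corollary2 (R : realType) (F : finFieldType) (Q : quiver)
    (hQ : two_connected Q) :
  let q : R := #|F|%:R in
  [/\ cvgn (A_seq R F Q), cvgn (B_seq R F Q)
    & B_lim R F Q / (1 - q^-1) ^+ #|vertex Q| = A_lim R F Q / (1 - q^-1)].
Proof.
move=> q; have [K K_ge0 step] := normalized_pairs_step R F hQ.
have r_bounds : 0 <= (3 / 4 : R) < 1 by lra.
have q1_neq0 : 1 - q^-1 != 0.
  by rewrite subr_eq0 gt_eqF // invf_lt1 ?ltr1n ?ltr0n ?(ltnW (finNzRing_gt1 F)) ?finNzRing_gt1.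
have [l cvg_b] : exists l : R, (normalized R F Q (nb_pairs F Q) @ \oo --> l)%classic.
  exists (limn (normalized R F Q (nb_pairs F Q))).
  by apply: (nondecreasing_cvgn_geometric K_ge0 r_bounds) => n; case: (step n).
set k := (1 - q^-1) / (1 - q^-1) ^+ #|vertex Q|.
have cvg_c : (normalized R F Q (nb_pairs_conn F Q) @ \oo --> l)%classic.
  apply: (cvg_dist_geometric (K := K) r_bounds) cvg_b => n.
  by case: (step n).
(* The identities are available for alpha = n + 1; the shift drops the degenerate term alpha = 0. *)
have cvg_B : (B_seq R F Q @ \oo --> l)%classic.
  by rewrite -cvg_shiftS (_ : [sequence _]_n = normalized R F Q (nb_pairs F Q)) //;
    apply/funext => n; apply: B_seqE.
have cvg_A : (A_seq R F Q @ \oo --> k * l)%classic.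
  rewrite -cvg_shiftS.
  rewrite (_ : [sequence _]_n = (fun n => k * normalized R F Q (nb_pairs_conn F Q) n)).
    by apply: cvgMr.
  by apply/funext => n; apply: A_seqE.
split; [exact: cvgP cvg_A|exact: cvgP cvg_B|].
rewrite /B_lim /A_lim (cvg_lim _ cvg_B) // (cvg_lim _ cvg_A) // /k.
by rewrite -mulrA mulrAC mulrCA divff // mul1r mulrC.
Qed.
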